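(* Let $k\ge 3$ be a constant integer and let $f(n)=o(\log\log n)$ be an arbitrary function with $f(n)\to\infty$. Let $A(n)$ be a random $k$-Apollonian network on $n+k$ vertices, and suppose that initially a vertex of $A(n)$ chosen uniformly at random knows a rumor. Then there is a constant $C>0$ such that, with probability $1-o(1)$ as $n\to\infty$, after $C\,(\log n)^{(k^2-3)/(k-1)^2}\cdot\log\log n\cdot f(n)^{2/k}$ rounds of the Push-Pull protocol, at least $n-o(n)$ vertices know the rumor.
   Context: Random $k$-Apollonian process: $A(0)$ is a clique on $k$ vertices, marked active. For $t=1,\dots,n$, $A(t)$ is obtained from $A(t-1)$ by choosing an active $k$-clique of $A(t-1)$ uniformly at random, creating a new vertex joined to all $k$ vertices of that clique; the chosen clique is marked non-active and the $k$ new $k$-cliques containing the new vertex are marked active. $A(n)$ is a random $k$-Apollonian network on $n+k$ vertices. Push-Pull protocol: in synchronous rounds, every informed vertex contacts a uniformly random neighbor and sends it the rumor, and every uninformed vertex contacts a uniformly random neighbor and receives the rumor if that neighbor knows it; all random choices are independent, and a vertex informed in a round cannot forward the rumor in that same round. *)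

(* Defs.v *)
From mathcomp Require Import all_boot all_order all_algebra.
From mathcomp Require Import all_classical all_reals all_analysis.
Set Implicit Arguments. Unset Strict Implicit. Unset Printing Implicit Defensive.
Import Order.TTheory GRing.Theory Num.Theory.
Local Open Scope ring_scope.

Section Dist.
Variable R : realType.

Definition dist (T : Type) := seq (R * T).
Definition dret (T : Type) (x : T) : dist T := [:: (1, x)].
Definition dbind (T U : Type) (d : dist T) (f : T -> dist U) : dist U :=
  flatten [seq [seq (px.1 * qy.1, qy.2) | qy <- f px.2] | px <- d].
Definition dunif (T : Type) (s : seq T) : dist T :=
  [seq ((size s)%:R^-1, x) | x <- s].
Definition prob (T : Type) (d : dist T) (P : T -> bool) : R :=
  \sum_(px <- d | P px.2) px.1.

(* state: list of active k-cliques (each a list of k vertices) and edge list.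
   Vertices are 0, ..., k + t - 1 at time t. *)
Record apstate := APState { ap_active : seq (seq nat); ap_edges : seq (nat * nat) }.

Definition ap_init (k : nat) : apstate :=
  APState [:: iota 0 k] [seq p <- [seq (i, j) | i <- iota 0 k, j <- iota 0 k] | (p.1 < p.2)%N].

(* step at time t+1 (t previous steps done), choosing the i-th active clique;
   new vertex is k + t; the chosen clique becomes non-active and the k cliques
   obtained by replacing one of its vertices by the new vertex become active *)
Definition ap_step (k t : nat) (st : apstate) (i : nat) : apstate :=
  let c := nth [::] (ap_active st) i in
  let v := (k + t)%N in
  APState (take i (ap_active st) ++ drop i.+1 (ap_active st)
             ++ [seq v :: rem x c | x <- c])
          ([seq (v, x) | x <- c] ++ ap_edges st).

Fixpoint apollonian (k t : nat) : dist apstate :=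
  match t with
  | 0 => dret (ap_init k)
  | t'.+1 => dbind (apollonian k t') (fun st =>
               dbind (dunif (iota 0 (size (ap_active st))))
                     (fun i => dret (ap_step k t' st i)))
  end.

Definition adj (st : apstate) (u w : nat) : bool :=
  ((u, w) \in ap_edges st) || ((w, u) \in ap_edges st).
Definition nbrs (N : nat) (st : apstate) (u : nat) : seq nat :=
  [seq w <- iota 0 N | adj st u w].

Fixpoint choices (N : nat) (st : apstate) (m : nat) : dist (nat -> nat) :=
  match m with
  | 0 => dret (fun _ => 0%N)
  | m'.+1 => dbind (choices N st m') (fun c =>
               dbind (dunif (nbrs N st m'))
                     (fun w => dret (fun v => if v == m' then w else c v)))
  end.

(* one synchronous round: v becomes informed if it was informed, if it pulls
   from an informed neighbour, or if an informed vertex pushes to it; only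
   vertices informed at the start of the round forward the rumor *)
Definition pp_update (N : nat) (I : nat -> bool) (c : nat -> nat) : nat -> bool :=
  fun v => [|| I v, I (c v) | has (fun u => I u && (c u == v)) (iota 0 N)].

Definition pp_round (N : nat) (st : apstate) (I : nat -> bool) : dist (nat -> bool) :=
  dbind (choices N st N) (fun c => dret (pp_update N I c)).

Fixpoint pushpull (N : nat) (st : apstate) (r : nat) (I : nat -> bool)
  : dist (nat -> bool) :=
  match r with
  | 0 => dret I
  | r'.+1 => dbind (pushpull N st r' I) (pp_round N st)
  end.

Definition experiment (k n r : nat) : dist (nat -> bool) :=
  dbind (apollonian k n) (fun st =>
    dbind (dunif (iota 0 (k + n))) (fun s =>
      pushpull (k + n) st r (fun v => v == s))).

Definition num_informed (k n : nat) (I : nat -> bool) : nat :=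
  count I (iota 0 (k + n)).

End Dist.

Definition rounds (R : realType) (k : nat) (C : R) (f : nat -> R) (n : nat) : nat :=
  absz (Num.ceil (C * powR (ln n%:R) ((k ^ 2 - 3)%N%:R / ((k - 1) ^ 2)%N%:R)
                    * ln (ln n%:R) * powR (f n) (2 / k%:R))).

(* Main.v *)
Require Import Defs.
From mathcomp Require Import all_boot all_order all_algebra.
From mathcomp Require Import all_classical all_reals all_analysis.
From mathcomp Require Import ring lra zify.
Import Order.TTheory GRing.Theory Num.Theory numFieldNormedType.Exports.
Local Open Scope classical_set_scope.
Local Open Scope ring_scope.

Set Implicit Arguments. Unset Strict Implicit. Unset Printing Implicit Defensive.

(* The rumor crosses an edge from [w] to [v] in expected time at most
   [min (deg w) (deg v)], so the time to go from the source to [v] is at most the sum of these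
   costs along any walk.  View the cliques as the leaves of a tree in which each new vertex
   [a] has as parent the youngest vertex [p] of the clique it was put in, and cross the edge
   [a p] through the youngest common neighbour [x] of [a] and [p] (or directly, if there
   is none).  At least [k - 1] active cliques contain [a] and [p], and hitting one of them
   renews [x] with degree [k]; the active cliques containing [x] number about
   [(k - 2) * deg x], so the drift of [deg x] is at most [2 k - deg x] over the number of
   active cliques.  This restoring force survives weighting by the number [B a] of active
   cliques below [a]: [E (deg x * B a) = O(E (B a))].  Hence the walks from a uniformly random
   vertex to the root cost on average [O(log n)], the mean depth in the tree, and Markov's
   inequality applies twice.  The exponent of [log n] in the theorem is at least [1], so
   [log n * log (log n)] rounds are available and [C = 1] works. *)

(** * Expectations and the Push-Pull protocol on a fixed graph *)

Section Expectation.
Variable R : realType.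

Definition expect (T : Type) (d : dist R T) (F : T -> R) : R :=
  \sum_(px <- d) px.1 * F px.2.

Lemma expect_ret (T : Type) (x : T) (F : T -> R) : expect (dret R x) F = F x.
Proof. by rewrite /expect /dret big_seq1 mul1r. Qed.

Lemma expect_bind (T U : Type) (d : dist R T) (h : T -> dist R U) (F : U -> R) :
  expect (dbind d h) F = expect d (fun x => expect (h x) F).
Proof.
rewrite /expect /dbind big_flatten /= big_map; apply: eq_bigr => px _.
by rewrite big_map mulr_sumr; apply: eq_bigr => qy _; rewrite mulrA.
Qed.

Lemma expect_unif (T : Type) (s : seq T) (F : T -> R) :
  expect (dunif R s) F = (size s)%:R^-1 * \sum_(x <- s) F x.
Proof. by rewrite /expect /dunif big_map mulr_sumr. Qed.

Lemma expect_unif_cst (T : Type) (s : seq T) (a : R) :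
  (0 < size s)%N -> expect (dunif R s) (fun=> a) = a.
Proof.
move=> s0; rewrite expect_unif big_const_seq count_predT iter_addr_0 mulrnAr.
by rewrite -mulrnAl -[_ *+ _]mulr_natr mulVf ?mul1r// pnatr_eq0 -lt0n.
Qed.

Lemma eq_expect (T : Type) (d : dist R T) (F G : T -> R) :
  F =1 G -> expect d F = expect d G.
Proof. by move=> FG; apply: eq_bigr => px _; rewrite FG. Qed.

Lemma expectD (T : Type) (d : dist R T) (F G : T -> R) :
  expect d (fun x => F x + G x) = expect d F + expect d G.
Proof. by rewrite /expect -big_split; apply: eq_bigr => px _; rewrite mulrDr. Qed.

Lemma expectZ (T : Type) (d : dist R T) (a : R) (F : T -> R) :
  expect d (fun x => a * F x) = a * expect d F.
Proof. by rewrite /expect mulr_sumr; apply: eq_bigr => px _; rewrite mulrCA. Qed.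

Lemma expectB (T : Type) (d : dist R T) (F G : T -> R) :
  expect d (fun x => F x - G x) = expect d F - expect d G.
Proof. by rewrite /expect -sumrB; apply: eq_bigr => px _; rewrite mulrBr. Qed.

Lemma expect_sum (T : Type) (d : dist R T) (I : Type) (s : seq I) (F : I -> T -> R) :
  expect d (fun x => \sum_(i <- s) F i x) = \sum_(i <- s) expect d (F i).
Proof.
by rewrite /expect exchange_big; apply: eq_bigr => px _; rewrite mulr_sumr.
Qed.

Lemma probE (T : Type) (d : dist R T) (P : T -> bool) :
  prob d P = expect d (fun x => (P x)%:R).
Proof. by rewrite /prob big_mkcond; apply: eq_bigr => px _; case: (P _); rewrite ?mulr1 ?mulr0. Qed.

(** Nonnegative weights are part of the notion, since they make [expect] monotone. Total mass one is
    kept apart, as the expectation of constants, because [dunif] of an empty list has mass zero. *)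
Definition supp (T : Type) (d : dist R T) (P : T -> Prop) : Prop :=
  List.Forall (fun px => 0 <= px.1 /\ P px.2) d.

Lemma supp_ret (T : Type) (x : T) (P : T -> Prop) : P x -> supp (dret R x) P.
Proof. by move=> Px; apply: List.Forall_cons. Qed.

Lemma supp_unif (T : eqType) (s : seq T) : supp (dunif R s) (fun x => x \in s).
Proof.
suff H u : {subset u <= s} ->
    List.Forall (fun px => 0 <= px.1 /\ px.2 \in s) [seq ((size s)%:R^-1 : R, x) | x <- u].
  exact: H.
elim: u => [|x u IH] us; first exact: List.Forall_nil.
apply: List.Forall_cons; first by rewrite /= us ?mem_head// invr_ge0.
by apply: IH => y yu; rewrite us// in_cons yu orbT.
Qed.

Lemma supp_bind (T U : Type) (d : dist R T) (h : T -> dist R U)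
    (P : T -> Prop) (Q : U -> Prop) :
  supp d P -> (forall x, P x -> supp (h x) Q) -> supp (dbind d h) Q.
Proof.
move=> dP hQ; rewrite /dbind; elim: d dP => [|[p x] d IH] dP /=; first exact: List.Forall_nil.
have [[/= p0 Px] dP'] := proj1 (List.Forall_cons_iff _ _ _) dP.
apply/List.Forall_app; split; last exact: IH.
have := hQ _ Px; elim: (h x) => [|[q y] e IHe] eQ /=; first exact: List.Forall_nil.
have [[/= q0 Qy] eQ'] := proj1 (List.Forall_cons_iff _ _ _) eQ.
by apply: List.Forall_cons; [split => //=; rewrite mulr_ge0 | exact: IHe].
Qed.

Lemma supp_imp (T : Type) (d : dist R T) (P Q : T -> Prop) :
  supp d P -> (forall x, P x -> Q x) -> supp d Q.
Proof. by move=> dP PQ; apply: List.Forall_impl dP => px [? /PQ]. Qed.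

Lemma ler_expect_supp (T : Type) (d : dist R T) (P : T -> Prop) (F G : T -> R) :
  supp d P -> (forall x, P x -> F x <= G x) -> expect d F <= expect d G.
Proof.
rewrite /expect => + FG; elim: d => [|[p x] d IH] dP; first by rewrite !big_nil.
have [[/= p0 Px] dP'] := proj1 (List.Forall_cons_iff _ _ _) dP.
by rewrite !big_cons lerD ?IH// ler_wpM2l// FG.
Qed.

Lemma eq_expect_supp (T : Type) (d : dist R T) (P : T -> Prop) (F G : T -> R) :
  supp d P -> (forall x, P x -> F x = G x) -> expect d F = expect d G.
Proof.
by move=> dP FG; apply/le_anti/andP; split; apply: ler_expect_supp dP _ => x /FG ->.
Qed.

End Expectation.

(** * Waiting times of Push-Pull along walks *)

Section PushPull.
Variables (R : realType) (N : nat) (st : apstate).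

Local Notation deg u := (size (nbrs N st u)).
Hypothesis deg_gt0 : forall u, (u < N)%N -> (0 < deg u)%N.

Lemma adj_sym u w : adj st u w = adj st w u.
Proof. by rewrite /adj orbC. Qed.

Lemma mem_nbrs u w : (w \in nbrs N st u) = (w < N)%N && adj st u w.
Proof. by rewrite mem_filter mem_iota andbC. Qed.

Lemma supp_choices m : supp (choices R N st m) (fun=> True).
Proof.
elim: m => [|m IH] /=; first exact: supp_ret.
apply: supp_bind IH _ => c _; apply: supp_bind (supp_unif R _) _ => w _.
exact: supp_ret.
Qed.

Lemma expect_choices_cst m a :
  (m <= N)%N -> expect (choices R N st m) (fun=> a) = a.
Proof.
elim: m => [|m IH] mN /=; first exact: expect_ret.
rewrite expect_bind -{2}(IH (ltnW mN)); apply: eq_expect => c.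
rewrite expect_bind -{2}(expect_unif_cst a (deg_gt0 mN)).
by apply: eq_expect => w; rewrite expect_ret.
Qed.

(** The value at [u] is drawn at stage [u]; the other stages leave it alone and have mass one. *)
Lemma choices_marginal m u x : (m <= N)%N -> (u < m)%N -> x \in nbrs N st u ->
  expect (choices R N st m) (fun c => (c u == x)%:R) = (deg u)%:R^-1.
Proof.
elim: m => // m IH mN um xu /=; rewrite expect_bind.
have [e|ne] := eqVneq u m.
  rewrite -[RHS](expect_choices_cst _ (ltnW mN)); apply: eq_expect => c.
  rewrite expect_bind expect_unif.
  under eq_bigr do rewrite expect_ret e eqxx.
  have xm : x \in nbrs N st m by rewrite -e.
  rewrite -natr_sum -big_mkcond/= sum1_count count_uniq_mem ?filter_uniq ?iota_uniq//.
  by rewrite xm mulr1 e.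
rewrite -(IH (ltnW mN) _ xu); last by rewrite ltn_neqAle ne -ltnS.
apply: eq_expect => c; rewrite expect_bind.
rewrite -[RHS](expect_unif_cst _ (deg_gt0 mN)).
by apply: eq_expect => w; rewrite expect_ret (negbTE ne).
Qed.

Definition miss (v : nat) (I : nat -> bool) : R := (~~ I v)%:R.

Lemma expect_round_cst I a : expect (pp_round R N st I) (fun=> a) = a.
Proof.
rewrite expect_bind -[RHS](expect_choices_cst _ (leqnn N)); apply: eq_expect => c.
exact: expect_ret.
Qed.

Lemma supp_round I : supp (pp_round R N st I) (fun J => forall v, I v -> J v).
Proof.
apply: supp_bind (supp_choices N) _ => c _; apply: supp_ret => v Iv.
by rewrite /pp_update Iv.
Qed.

Lemma miss_round_le v I : expect (pp_round R N st I) (miss v) <= miss v I.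
Proof.
rewrite -[leRHS](expect_round_cst I); apply: ler_expect_supp (supp_round I) _ => J IJ.
by rewrite /miss ler_nat; have := IJ v; case: (I v) (J v) => [|] [|] // /(_ isT).
Qed.

(** A single contact, of [x] by [u], is enough to inform [v]. A push is the case [u = w], [x = v],
    and a pull the case [u = v], [x = w]. *)
Lemma contact_round_le w v u x (I : nat -> bool) (J := fun c => pp_update N I c v) :
    (u < N)%N -> x \in nbrs N st u ->
    (forall c, I w -> c u = x -> J c) ->
  expect (pp_round R N st I) (miss v) <= miss v I - (deg u)%:R^-1 * (~~ I v && I w)%:R.
Proof.
move=> uN xu hJ; have [/andP[nIv Iw]|h] := boolP (~~ I v && I w); last first.
  by rewrite mulr0 subr0 miss_round_le.
rewrite /miss nIv mulr1 -(choices_marginal (leqnn N) uN xu).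
rewrite -[X in X - _](expect_choices_cst _ (leqnn N)) -expectB expect_bind.
apply: ler_expect_supp (supp_choices N) _ => c _; rewrite expect_ret.
have [cu|_] := eqVneq (c u) x; first by rewrite [pp_update _ _ _ _]hJ// subrr.
by rewrite subr0 lern1 leq_b1.
Qed.

Lemma edge_round_le w v e I : (v < N)%N -> (w < N)%N -> adj st w v ->
    (minn (deg w) (deg v) <= e)%N ->
  expect (pp_round R N st I) (miss v) <= miss v I - e%:R^-1 * (~~ I v && I w)%:R.
Proof.
move=> vN wN wv; rewrite geq_min => he.
(* The caller [u] is an end of degree at most [e]: [w] pushes or [v] pulls. *)
have [u [x [uN xu ue hJ]]] : exists u x, [/\ (u < N)%N, x \in nbrs N st u, (deg u <= e)%N &
    forall c, I w -> c u = x -> pp_update N I c v].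
  case/orP: he => he.
    exists w, v; split => //; first by rewrite mem_nbrs vN.
    move=> c Iw cw; rewrite /pp_update; apply/or3P/Or33/hasP; exists w; rewrite ?mem_iota//.
    by rewrite Iw cw eqxx.
  exists v, w; split => //; first by rewrite mem_nbrs wN adj_sym.
  by move=> c Iw cv; rewrite /pp_update cv Iw orbT.
apply: (le_trans (contact_round_le uN xu hJ)); rewrite lerD2l lerN2 ler_wpM2r//.
have d0 := deg_gt0 uN; rewrite lef_pV2 ?posrE ?ltr0n ?ler_nat//.
exact: leq_trans ue.
Qed.

(* The last index is any upper bound on the total cost of some walk. *)
Inductive walk (s : nat) : nat -> nat -> Prop :=
| walk0 : walk s s 0
| walkS w v d e : walk s w d -> (w < N)%N -> (v < N)%N -> adj st w v ->
    (minn (deg w) (deg v) <= e)%N -> walk s v (d + e).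

Lemma walk1 w v e : (w < N)%N -> (v < N)%N -> adj st w v ->
  (minn (deg w) (deg v) <= e)%N -> walk w v e.
Proof. by move=> *; rewrite -[e]add0n; apply: walkS (walk0 w) _ _ _ _. Qed.

Lemma walk_trans s w v d e : walk s w d -> walk w v e -> walk s v (d + e).
Proof.
move=> sw; elim=> [|x y d' e' _ IH xN yN xy he]; first by rewrite addn0.
by rewrite addnA; apply: walkS IH _ _ _ _.
Qed.

Lemma walk_sym s v d : walk s v d -> walk v s d.
Proof.
elim=> [|x y d' e' _ IH xN yN xy he]; first exact: walk0.
by rewrite addnC; apply: walk_trans IH; apply: walk1; rewrite // 1?adj_sym// minnC.
Qed.

Lemma expect_pushpull_cst r I a : expect (pushpull R N st r I) (fun=> a) = a.
Proof.
elim: r => [|r IH] /=; first exact: expect_ret.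
by rewrite expect_bind -[RHS]IH; apply: eq_expect => J; rewrite expect_round_cst.
Qed.

Lemma supp_pushpull r I : supp (pushpull R N st r I) (fun J => forall v, I v -> J v).
Proof.
elim: r => [|r IH] /=; first exact: supp_ret.
apply: supp_bind IH _ => J IJ; apply: supp_imp (supp_round J) _ => K JK v /IJ; exact: JK.
Qed.

(* [w] informed and [v] not informed lasts [e] rounds on average, because each such round
   informs [v] with probability at least [e^-1]. *)
Lemma sum_miss_le s v d r : walk s v d ->
  \sum_(t < r) expect (pushpull R N st t (fun u => u == s)) (miss v) <= d%:R.
Proof.
elim=> [|w {}v {}d e _ IH wN vN wv he].
  rewrite big1// => t _; rewrite -[RHS](expect_pushpull_cst t (fun u => u == s)).
  apply: eq_expect_supp (supp_pushpull t _) _ => J /(_ s (eqxx s)).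
  by rewrite /miss => ->.
pose q u t := expect (pushpull R N st t (fun u => u == s)) (miss u).
have e0 : (0 : R) < e%:R.
  by rewrite ltr0n; apply: leq_trans he; rewrite leq_min !deg_gt0.
pose p t := expect (pushpull R N st t (fun u => u == s)) (fun J => (~~ J v && J w)%:R).
have q_step t : p t <= e%:R * (q v t - q v t.+1).
  rewrite -ler_pdivrMl// lerBrDl -lerBrDr /q /= expect_bind -expectZ -expectB.
  by apply: ler_expect_supp (supp_pushpull t _) _ => J _; apply: edge_round_le.
have q_bound t : 0 <= q v t <= 1.
  rewrite -[X in _ <= _ <= X](expect_pushpull_cst t (fun u => u == s)).
  rewrite -[X in X <= _ <= _](expect_pushpull_cst t (fun u => u == s)).
  apply/andP; split; apply: ler_expect_supp (supp_pushpull t _) _ => J _; rewrite ?ler0n//.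
  by rewrite lern1 leq_b1.
(* By [q_step] the sum telescopes, and [q v] stays between 0 and 1. *)
have hp : \sum_(t < r) p t <= e%:R.
  apply: (@le_trans _ _ (e%:R * (q v 0%N - q v r))).
    elim: r {IH} => [|r IHr]; first by rewrite big_ord0 subrr mulr0.
    rewrite big_ord_recr; apply: le_trans (lerD IHr (q_step r)) _.
    by rewrite -mulrDr addrA subrK.
  have /andP[_ q01] := q_bound 0%N; have /andP[qr0 _] := q_bound r.
  by rewrite -[leRHS]mulr1 ler_pM2l// lerBlDr (le_trans q01)// lerDl.
(* While [v] is uninformed, either [w] is informed, which [hp] counts, or [w] is uninformed too,
   which the induction hypothesis counts. *)
rewrite natrD; apply: le_trans (lerD IH hp).
rewrite -big_split /=; apply: ler_sum => t _.
rewrite -expectD; apply: ler_expect_supp (supp_pushpull t _) _ => J _.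
by rewrite /miss -natrD ler_nat; case: (J v) (J w) => [|] [|].
Qed.

(** The probability that [v] is uninformed decreases with time, so [r] times its value at time [r]
    is at most the sum over the first [r] rounds. *)
Lemma miss_pushpull_le s v d r : walk s v d ->
  r%:R * expect (pushpull R N st r (fun u => u == s)) (miss v) <= d%:R.
Proof.
move=> sv; apply: le_trans (sum_miss_le r sv).
pose q t := expect (pushpull R N st t (fun u => u == s)) (miss v).
have q_dec t : q t.+1 <= q t.
  rewrite /q /= expect_bind.
  by apply: ler_expect_supp (supp_pushpull t _) _ => J _; apply: miss_round_le.
have q_min t : (t <= r)%N -> q r <= q t.
  move=> tr; rewrite -(subnK tr); elim: (r - t)%N => // j IH.
  exact: le_trans (q_dec _) IH.
rewrite mulr_natl -[r in _ *+ r]card_ord -sumr_const; apply: ler_sum => t _.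
exact/q_min/ltnW.
Qed.

End PushPull.

(** * The labelled Apollonian network *)

Section Network.
Local Open Scope nat_scope.

Definition split_clique (v : nat) (c : seq nat) := [seq v :: rem x c | x <- c].

Lemma count_split_old v c y : uniq c -> y != v ->
  count (fun d => y \in d) (split_clique v c) = (y \in c) * (size c).-1.
Proof.
move=> uc yv; rewrite count_map.
rewrite (@eq_count _ _ (fun x => (y != x) && (y \in c))); last first.
  by move=> x /=; rewrite in_cons (negbTE yv) /= mem_rem_uniq// inE.
have [yc|nyc] := boolP (y \in c); last by rewrite (@eq_count _ _ pred0) ?count_pred0// => x; rewrite andbF.
have := count_predC (pred1 y) c; rewrite count_uniq_mem// yc mul1n => <-.
by rewrite add1n /=; apply: eq_count => x /=; rewrite andbT eq_sym.
Qed.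

Lemma count_split_new v c : count (fun d => v \in d) (split_clique v c) = size c.
Proof.
rewrite count_map (@eq_count _ _ predT) ?count_predT// => x /=.
by rewrite in_cons eqxx.
Qed.

Lemma count_split_new_pair v c y : uniq c -> y != v ->
  count (fun d => (v \in d) && (y \in d)) (split_clique v c) = (y \in c) * (size c).-1.
Proof.
move=> uc yv; rewrite -(count_split_old uc yv) !count_map; apply: eq_count => x /=.
by rewrite !in_cons eqxx.
Qed.

(** Exactly the two pieces that drop [y] or [z] fail to contain both. *)
Lemma count_split_pair v c y z : uniq c -> y != v -> z != v -> y != z ->
  y \in c -> z \in c ->
  (count (fun d => (y \in d) && (z \in d)) (split_clique v c)).+2 = size c.
Proof.
move=> uc yv zv yz yc zc; rewrite count_map.
rewrite (@eq_count _ _ (predC (pred2 y z))); last first.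
  move=> x /=; rewrite !in_cons (negbTE yv) (negbTE zv) /= !mem_rem_uniq// !inE yc zc !andbT.
  by rewrite negb_or (eq_sym x y) (eq_sym x z).
rewrite -(count_predC (pred2 y z) c) -addn2 addnC; congr (_ + _).
have := count_predUI (pred1 y) (pred1 z) c.
rewrite (@eq_count _ (predI _ _) pred0) ?count_pred0 ?addn0; last first.
  by move=> x /=; apply: contraNF yz => /andP[/eqP<- /eqP->].
by rewrite !count_uniq_mem// yc zc => ->.
Qed.

Lemma count_split_head v c (P : pred nat) :
  count (fun d => P (head 0 d)) (split_clique v c) = P v * size c.
Proof.
rewrite count_map /preim /=; case: (P v); last by rewrite count_pred0.
by rewrite mul1n -[RHS]count_predT.
Qed.

Lemma mem_split v c d : uniq c -> d \in split_clique v c ->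
  [/\ head 0 d = v, v \in d, forall x, x \in d -> (x == v) || (x \in c) & size d = size c].
Proof.
move=> uc /mapP[x xc ->] /=; split=> //; rewrite ?mem_head//.
  by move=> y; rewrite in_cons => /orP[->//|/mem_rem->]; rewrite orbT.
by rewrite size_rem//; case: (c) xc.
Qed.

Lemma uniq_split v c d : uniq c -> v \notin c -> d \in split_clique v c -> uniq d.
Proof.
move=> uc vc /mapP[x xc ->] /=; rewrite rem_uniq// andbT.
by apply: contra vc => /mem_rem.
Qed.

Section Step.
Variables (k t : nat) (st : apstate) (i : nat).
Local Notation act := (ap_active st).
Local Notation c := (nth [::] act i).
Local Notation v := (k + t).
Local Notation st' := (ap_step k t st i).
Hypothesis i_lt : i < size act.

(** The hit clique is swapped for its pieces; keeping [P c] on the left avoids truncated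
    subtraction. *)
Lemma count_step (P : pred (seq nat)) :
  count P (ap_active st') + P c = count P act + count P (split_clique v c).
Proof.
have -> : count P act = count P (take i act) + (P c + count P (drop i.+1 act)).
  by rewrite -{1}[act](cat_take_drop i) count_cat (drop_nth [::] i_lt).
by rewrite /= !count_cat -/(split_clique v c); lia.
Qed.

Lemma mem_step d : d \in ap_active st' -> (d \in act) || (d \in split_clique v c).
Proof.
rewrite !mem_cat => /or3P[/mem_take->//|/mem_drop->//|]; by rewrite orbC => ->.
Qed.

Lemma adj_step u w :
  adj st' u w = [|| adj st u w, (u == v) && (w \in c) | (w == v) && (u \in c)].
Proof.
have E x y : ((x, y) \in [seq (v, z) | z <- c]) = (x == v) && (y \in c).
  apply/mapP/andP => [[z zc [-> ->]]|[/eqP-> yc]]; by [split | exists y].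
by rewrite /adj /= !mem_cat !E; do !case: (_ \in _) => //=; do !case: (_ == _).
Qed.

Hypothesis adj_lt : forall u w, adj st u w -> (u < v) && (w < v).
Hypothesis c_lt : forall x, x \in c -> x < v.
Hypothesis c_uniq : uniq c.

Lemma deg_step_old u : u < v ->
  size (nbrs v.+1 st' u) = size (nbrs v st u) + (u \in c).
Proof.
move=> uv; rewrite /nbrs !size_filter -addn1 iotaD count_cat /= add0n addn0.
congr (_ + _); last first.
  rewrite adj_step eqxx (ltn_eqF uv) /=; case: (boolP (adj _ _ _)) => // /adj_lt.
  by rewrite ltnn andbF.
apply: eq_in_count => w; rewrite mem_iota /= add0n => wv.
by rewrite adj_step (ltn_eqF uv) (ltn_eqF wv) !orbF.
Qed.

Lemma deg_step_new : size (nbrs v.+1 st' v) = size c.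
Proof.
apply/perm_size/uniq_perm; rewrite ?filter_uniq ?iota_uniq// => w.
rewrite mem_nbrs adj_step eqxx /=.
have /negbTE-> : ~~ adj st v w by apply/negP => /adj_lt; rewrite ltnn.
have -> : (v \in c) = false by apply/negP => /c_lt; rewrite ltnn.
rewrite andbF orbF /=; case: (boolP (w \in c)) => [/c_lt/ltnW wv|]; last by rewrite andbF.
by rewrite ltnS wv.
Qed.

End Step.

(* Only meaningful at vertices [a >= k]: [anc L u a] says that [a] is an ancestor of [u] (or
   [u] itself), [wit L a] is the youngest common neighbour of [a] and [par L a] ([a] itself
   if there is none), and [k + exc L a] bounds its degree.  The tree node of an active clique is
   its head, since [ap_step] puts the new vertex in front. *)
Record labels := Labels {
  par : nat -> nat;
  anc : nat -> nat -> bool;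
  wit : nat -> nat;
  exc : nat -> nat }.

Definition labels0 : labels :=
  Labels (fun=> 0) (fun _ _ => false) (fun=> 0) (fun=> 0).

(** For [a] and its parent both in [c], the new vertex [v] becomes a common neighbour. For [a = v]
    the witness is [v] itself, which encodes the direct edge. *)
Definition renewed (v : nat) (c : seq nat) (L : labels) (a : nat) : bool :=
  (a == v) || ((a \in c) && (par L a \in c)).

Definition label_step (v : nat) (c : seq nat) (L : labels) : labels :=
  Labels (fun a => if a == v then head 0 c else par L a)
         (fun u a => if u == v then (a == v) || anc L (head 0 c) a else anc L u a)
         (fun a => if renewed v c L a then v else wit L a)
         (fun a => if renewed v c L a then 0 else exc L a + (wit L a \in c)).

(** The tree nodes are the root 0 and the vertices from [k] on. [inv_wcount]: a fresh witness lies
    in [k] cliques, and each hit removes one and adds [k - 1]. [inv_pcount]: a new tree edge lies in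
    [k - 1] cliques. [inv_sub]: cliques meeting [a] or its witness are below [a]. [inv_vcount]: a
    hit below [a] adds one vertex and a net [k - 1] cliques. *)
Record network_inv (k t : nat) (st : apstate) (L : labels) : Prop := NetworkInv {
  inv_size : size (ap_active st) = 1 + (k - 1) * t;
  inv_clique : forall c, c \in ap_active st ->
    [/\ uniq c, size c = k, (forall x, x \in c -> x < k + t)
      & (head 0 c == 0) || (k <= head 0 c)];
  inv_adj : forall u w, adj st u w -> (u < k + t) && (w < k + t);
  inv_deg : forall u, u < k + t -> 0 < size (nbrs (k + t) st u);
  inv_par : forall a, k <= a < k + t -> (par L a < a) && ((par L a == 0) || (k <= par L a));
  inv_anc : forall a x, k <= a < k + t -> anc L a x = (x == a) || anc L (par L a) x;
  inv_anc_le : forall u x, u < k + t -> anc L u x -> x <= u;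
  inv_anc0 : forall x, anc L 0 x = false;
  inv_wit : forall a, k <= a < k + t ->
    [/\ wit L a < k + t, (wit L a == a) || adj st a (wit L a) & adj st (wit L a) (par L a)];
  inv_wdeg : forall a, k <= a < k + t -> size (nbrs (k + t) st (wit L a)) <= k + exc L a;
  inv_sub : forall a c, k <= a < k + t -> c \in ap_active st ->
    (a \in c) || (wit L a \in c) -> anc L (head 0 c) a;
  inv_wcount : forall a, k <= a < k + t ->
    count (fun c => wit L a \in c) (ap_active st) <= k + exc L a * (k - 2);
  inv_pcount : forall a, k <= a < k + t ->
    k - 1 <= count (fun c => (a \in c) && (par L a \in c)) (ap_active st);
  inv_vcount : forall a, k <= a < k + t ->
    count (fun u => anc L u a) (iota k t) <= count (fun c => anc L (head 0 c) a) (ap_active st) }.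

Lemma inv_init k : 3 <= k -> network_inv k 0 (ap_init k) labels0.
Proof.
move=> k3; have k0 : 0 < k by lia.
have E u w : ((u, w) \in ap_edges (ap_init k)) = [&& u < w, u < k & w < k].
  rewrite mem_filter /=; congr (_ && _); apply/allpairsP/andP => [[p []]|[uk wk]].
    by rewrite !mem_iota => /= ? ? [-> ->].
  by exists (u, w); rewrite !mem_iota.
have A u w : adj (ap_init k) u w = [&& u != w, u < k & w < k].
  by rewrite /adj !E; lia.
split; rewrite ?addn0 ?muln0//; try (by move=> a; lia).
- move=> c; rewrite inE => /eqP->; split; rewrite ?iota_uniq ?size_iota//.
    by move=> x; rewrite mem_iota.
  by case: k k0 {k3 E A}.
- by move=> u w; rewrite A => /andP[].
- move=> u uk; rewrite -has_predT; apply/hasP; exists (u == 0 : nat) => //.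
  by rewrite mem_nbrs A; case: eqP => /=; lia.
Qed.

(** * Preservation of the invariants by one step *)

Section InvStep.
Variables (k t : nat) (st : apstate) (L : labels) (i : nat).
Local Notation act := (ap_active st).
Local Notation c := (nth [::] act i).
Local Notation v := (k + t).
Local Notation st' := (ap_step k t st i).
Local Notation L' := (label_step v c L).
Hypothesis k_ge3 : 3 <= k.
Hypothesis I : network_inv k t st L.
Hypothesis i_lt : i < size act.

Let c_act : c \in act. Proof. exact: mem_nth. Qed.
Let c_uniq : uniq c. Proof. by have [] := inv_clique I c_act. Qed.
Let c_size : size c = k. Proof. by have [] := inv_clique I c_act. Qed.
Let c_lt x : x \in c -> x < v. Proof. by have [_ _ + _] := inv_clique I c_act; apply. Qed.
Let v_c : v \notin c. Proof. by apply/negP => /c_lt; rewrite ltnn. Qed.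
Let head_c d : d \in act -> head 0 d \in d.
Proof. by case: d => [|x d] /(inv_clique I)[_ /= dk _ _]; [lia | rewrite mem_head]. Qed.
Let head_lt d : d \in act -> head 0 d < v.
Proof. by move=> da; have [_ _ + _] := inv_clique I da; apply; apply: head_c. Qed.

Let v_act d : d \in act -> v \notin d.
Proof. by move=> da; have [_ _ dl _] := inv_clique I da; apply/negP => /dl; rewrite ltnn. Qed.

Lemma label_step_old a : k <= a < v ->
  [/\ par L a < v, wit L a < v, a != v, par L a != v & wit L a != v].
Proof.
move=> /andP[ka av]; have av' : k <= a < v by rewrite ka.
have /andP[pa _] := inv_par I av'; have [wa _ _] := inv_wit I av'.
by split; lia.
Qed.

Lemma renewed_old a : k <= a < v -> renewed v c L a = (a \in c) && (par L a \in c).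
Proof. by move=> /andP[_ av]; rewrite /renewed (ltn_eqF av). Qed.

(** The parent of the new vertex is the head of [c], so all [k] pieces are below [a] exactly when
    [c] is. *)
Lemma count_anc_step a : a != v ->
  count (fun d => anc L' (head 0 d) a) (ap_active st') =
    count (fun d => anc L (head 0 d) a) act + anc L (head 0 c) a * (k - 1).
Proof.
move=> av; have := count_step k t i_lt (fun d => anc L' (head 0 d) a).
rewrite (count_split_head v c (anc L' ^~ a)) /= eqxx (negbTE av) /=.
rewrite (ltn_eqF (head_lt c_act)) c_size.
rewrite (@eq_in_count _ (fun d => if head 0 d == v then _ else _)
  (fun d => anc L (head 0 d) a) act); last by move=> d da; rewrite (ltn_eqF (head_lt da)).
by case: (anc L (head 0 c) a) => /=; lia.
Qed.

Lemma count_anc_new :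
  count (fun d => anc L' (head 0 d) v) (ap_active st') = k.
Proof.
have := count_step k t i_lt (fun d => anc L' (head 0 d) v).
rewrite (count_split_head v c (anc L' ^~ v)) /= !eqxx /= c_size (ltn_eqF (head_lt c_act)) mul1n.
have anc_v d : d \in act -> anc L (head 0 d) v = false.
  move=> da; apply/negP => /(inv_anc_le I (head_lt da)).
  by rewrite leqNgt head_lt.
rewrite anc_v// addn0 => ->; rewrite (@eq_in_count _ _ pred0) ?count_pred0// => d da.
by rewrite (ltn_eqF (head_lt da)) anc_v.
Qed.

Lemma inv_step : network_inv k t.+1 st' L'.
Proof.
have old_new a : k <= a < k + t.+1 -> k <= a < v \/ a = v by lia.
have kv : k <= v by lia.
have ren_v : renewed v c L v by rewrite /renewed eqxx.
have headv : head 0 c < v := head_lt c_act.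
have step_old d : d \in ap_active st' ->
    d \in act \/ [/\ head 0 d = v, v \in d, forall x, x \in d -> (x == v) || (x \in c),
      size d = k & uniq d].
  move=> /mem_step/orP[|ds]; first by left.
  have [? ? ?] := mem_split c_uniq ds; rewrite c_size => ?.
  by right; split=> //; apply: uniq_split ds.
have adj_old u w : adj st u w -> adj st' u w by rewrite adj_step => ->.
have degS_old := @deg_step_old k t st i (inv_adj I).
have degS_new := @deg_step_new k t st i (inv_adj I) c_lt c_uniq.
split.
- have := count_step k t i_lt predT.
  by rewrite !count_predT (inv_size I) size_map c_size /=; lia.
- move=> d /step_old[/(inv_clique I)[du dk dl dh]|[hd vd ds dk du]].
    by split=> // x /dl; lia.
  split; rewrite // ?hd ?kv ?orbT// => x /ds/orP[/eqP->|/c_lt]; lia.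
- move=> u w; rewrite adj_step => /or3P[/(inv_adj I)|/andP[/eqP-> /c_lt]|/andP[/eqP-> /c_lt]]; lia.
- move=> u; rewrite addnS ltnS leq_eqVlt => /orP[/eqP->|uv]; first by rewrite degS_new c_size; lia.
  by rewrite degS_old// ltn_addr// (inv_deg I).
- move=> a /old_new[aa|->] /=.
    by have [_ _ /negbTE-> _ _] := label_step_old aa; apply: inv_par I _ aa.
  by rewrite eqxx headv; have [_ _ _ ->] := inv_clique I c_act.
- move=> a x /old_new[aa|->] /=; last by rewrite eqxx (ltn_eqF headv).
  have [pv _ /negbTE-> _ _] := label_step_old aa.
  by rewrite (ltn_eqF pv) (inv_anc I x aa).
- move=> u x; rewrite addnS ltnS leq_eqVlt => /orP[/eqP->|uv] /=.
    rewrite eqxx => /orP[/eqP->//|/(inv_anc_le I headv)]; lia.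
  by rewrite (ltn_eqF uv); exact: (inv_anc_le I uv).
- by move=> x /=; rewrite ltn_eqF ?(inv_anc0 I)//; lia.
- move=> a /old_new[aa|->]; last first.
    by rewrite /= ren_v !eqxx; split; [lia | | rewrite adj_step eqxx head_c// orbT].
  have [_ _ /negbTE av _ _] := label_step_old aa; rewrite /= av renewed_old//.
  case: ifP => [/andP[ac pc]|_].
    by rewrite !adj_step !eqxx ac pc !orbT; split=> //; lia.
  have [wa wb wc] := inv_wit I aa.
  split; [lia| |exact: adj_old].
  by case/orP: wb => [->//|/adj_old->]; rewrite orbT.
- move=> a /old_new[aa|->]; rewrite addnS /=; last by rewrite ren_v degS_new c_size; lia.
  have [_ wa _ _ _] := label_step_old aa; rewrite renewed_old//.
  case: ifP => _; first by rewrite degS_new c_size; lia.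
  by rewrite degS_old// addnA leq_add2r (inv_wdeg I).
- move=> a d /old_new[aa|->] /step_old[da|[hd vd ds dk du]]; last 2 first.
  + by rewrite /= ren_v orbb (negbTE (v_act da)).
  + by rewrite /= hd !eqxx.
  + have [_ _ av _ _] := label_step_old aa.
    rewrite /= (ltn_eqF (head_lt da)); case: ifP => [_|_]; last exact: (inv_sub I aa da).
    by rewrite (negbTE (v_act da)) orbF => ad; apply: (inv_sub I) => //; rewrite ad.
  have [_ _ /negbTE av _ /negbTE wv] := label_step_old aa.
  rewrite /= hd eqxx av /= renewed_old//.
  (* The piece is below [a] as soon as [c] is. A renewed edge has [a] in [c]; otherwise [a] and its
     witness differ from [v], so whichever lies in the piece lies in [c]. *)
  have suba : a \in c -> anc L (head 0 c) a by move=> ac; apply: (inv_sub I) => //; rewrite ac.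
  case: ifP => [/andP[/suba->]//|_].
  case/orP => [/ds|/ds]; first by rewrite av => /suba.
  by rewrite wv /= => wc; apply: (inv_sub I) => //; rewrite wc orbT.
- have vact : count (fun d => v \in d) act = 0.
    rewrite (@eq_in_count _ _ pred0) ?count_pred0// => d da.
    exact/negbTE/v_act.
  have vcount : count (fun d => v \in d) (ap_active st') = k.
    have := count_step k t i_lt (fun d => v \in d).
    by rewrite count_split_new vact c_size (negbTE v_c) addn0.
  move=> a /old_new[aa|->]; rewrite /= ?ren_v ?vcount ?mul0n ?addn0//.
  have [_ _ av _ wv] := label_step_old aa; rewrite renewed_old//.
  case: ifP => _; first by rewrite vcount; lia.
  have := count_step k t i_lt (fun d => wit L a \in d).
  rewrite count_split_old// c_size; have := inv_wcount I aa.
  by case: (wit L a \in c) => /=; lia.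
- move=> a /old_new[aa|->]; rewrite /=.
    have [_ _ av pv _] := label_step_old aa; rewrite (negbTE av).
    pose P (d : seq nat) := (a \in d) && (par L a \in d).
    suff : k - 1 <= count P (ap_active st') by [].
    have aP : k - 1 <= count P act := inv_pcount I aa.
    have := count_step k t i_lt P; have [/andP[ac pc]|_] := boolP (P c); last by lia.
    have /andP[pa _] := inv_par I aa.
    (* The hit clique is replaced by [k - 2] pieces through both ends, at least one as [k] is at
       least 3. *)
    have : (count P (split_clique v c)).+2 = size c.
      exact: count_split_pair c_uniq av pv (negbT (gtn_eqF pa)) ac pc.
    by rewrite c_size; lia.
  rewrite eqxx; have := count_step k t i_lt (fun d => (v \in d) && (head 0 c \in d)).
  rewrite count_split_new_pair ?neq_ltn ?headv// head_c// c_size (negbTE v_c) /=; lia.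
- move=> a /old_new[aa|->].
    have [_ _ av _ _] := label_step_old aa; rewrite (count_anc_step av).
    rewrite -addn1 iotaD count_cat /= eqxx (negbTE av) /=.
    rewrite (@eq_in_count _ _ (anc L ^~ a)); last first.
      by move=> u; rewrite mem_iota => /andP[_ uv]; rewrite (ltn_eqF uv).
    by have := inv_vcount I aa; case: (anc L (head 0 c) a) => /=; lia.
  rewrite count_anc_new -addn1 iotaD count_cat /= !eqxx.
  rewrite (@eq_in_count _ _ pred0) ?count_pred0; first by lia.
  move=> u; rewrite mem_iota => /andP[_ uv]; rewrite (ltn_eqF uv).
  by apply/negP => /(inv_anc_le I uv); lia.
Qed.

End InvStep.

End Network.

(** * Walks to the root and their total cost *)

Section RootWalk.
Variables (k t : nat) (st : apstate) (L : labels).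
Hypothesis I : network_inv k t st L.
Local Open Scope nat_scope.
Local Notation N := (k + t).

(** Each tree edge above [u] is charged one witness degree; crossing it costs twice that. The
    filtered sum over all [a] lets sums over [u] and [a] be exchanged. *)
Definition root_cost (u : nat) : nat :=
  \sum_(a <- iota k t | anc L u a) (k + exc L a).

Lemma root_cost_initial u : u < N -> (u == 0) || (u < k) -> root_cost u = 0.
Proof.
move=> uN u0; rewrite /root_cost big_seq_cond big1// => a; rewrite mem_iota.
case/andP=> /andP[ka _]; case/orP: u0 => [/eqP->|uk]; first by rewrite (inv_anc0 I).
by move=> /(inv_anc_le I uN); lia.
Qed.

Lemma root_cost_par u : k <= u < N -> root_cost u = k + exc L u + root_cost (par L u).
Proof.
move=> uN; have /andP[pu _] := inv_par I uN.
have -> : k + exc L u = \sum_(a <- iota k t | a == u) (k + exc L a).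
  rewrite big_mkcond (bigD1_seq u) ?mem_iota ?iota_uniq//= eqxx big1 ?addn0// => a.
  by move/negbTE->.
rewrite /root_cost big_mkcond [X in X + _]big_mkcond [X in _ + X]big_mkcond -big_split /=.
apply: eq_bigr => a _; rewrite (inv_anc I a uN); have [->|//] := eqVneq a u.
rewrite /= ifF ?addn0//; apply/negP => /(inv_anc_le I _); lia.
Qed.

(** Both edges at the witness cost at most its degree. When the witness is [u] itself, one direct
    edge suffices. *)
Lemma walk_par u : k <= u < N -> walk N st (par L u) u (2 * (k + exc L u)).
Proof.
move=> uN; have /andP[pu _] := inv_par I uN; have [wN uw wp] := inv_wit I uN.
have wd := inv_wdeg I uN.
have step : walk N st (par L u) (wit L u) (k + exc L u).
  by apply: walk1; rewrite 1?adj_sym//; [lia | rewrite geq_min wd orbT].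
rewrite mul2n -addnn; case/orP: uw => [/eqP e|uw].
  rewrite e in wp wd.
  by apply: walk1; rewrite 1?adj_sym//; [lia | lia | rewrite geq_min (leq_trans wd) ?leq_addr ?orbT].
by apply: walk_trans step _; apply: walk1; rewrite 1?adj_sym//; [lia | rewrite geq_min wd].
Qed.

Lemma walk_root u : u < N -> (u == 0) || (k <= u) -> walk N st 0 u (2 * root_cost u).
Proof.
elim/ltn_ind: u => u IH; have [-> N0 _|u0 uN /= ku] := eqVneq u 0.
  by rewrite (root_cost_initial N0)// muln0; exact: walk0.
have uN' : k <= u < N by rewrite ku.
have /andP[pu p0] := inv_par I uN'.
have -> : 2 * root_cost u = 2 * root_cost (par L u) + 2 * (k + exc L u).
  by rewrite root_cost_par//; lia.
by apply: walk_trans (walk_par uN'); apply: IH => //; lia.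
Qed.

Definition descendants (a : nat) : nat :=
  count (fun c => anc L (head 0 c) a) (ap_active st).

(** After exchanging sums, [a] is charged once per vertex below it, and by [inv_vcount] there are at
    least as many active cliques below it. *)
Lemma sum_root_cost :
  \sum_(u <- iota 0 N) root_cost u <=
    \sum_(a <- iota k t) (k + exc L a) * descendants a.
Proof.
rewrite iotaD big_cat /= add0n big_seq big1 ?add0n; last first.
  by move=> u; rewrite mem_iota => /= uk; apply: root_cost_initial; lia.
rewrite (eq_bigr (fun u => \sum_(a <- iota k t) (if anc L u a then k + exc L a else 0))); last first.
  by move=> u _; rewrite /root_cost big_mkcond.
rewrite exchange_big big_seq [leqRHS]big_seq; apply: leq_sum => a; rewrite mem_iota => aN.
rewrite -big_mkcond big_const_seq iter_addn_0 leq_mul2l.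
by rewrite (inv_vcount I aN) orbT.
Qed.

End RootWalk.

Lemma sum_pairs (R : realType) (T : Type) (r : seq T) (F : T -> R) :
  \sum_(x <- r) \sum_(y <- r) (F x + F y) = (size r)%:R * (2 * \sum_(x <- r) F x).
Proof.
have cst a : \sum_(x <- r) a = (size r)%:R * a.
  by rewrite big_const_seq count_predT iter_addr_0 mulr_natl.
rewrite (eq_bigr (fun x => (size r)%:R * F x + \sum_(y <- r) F y)); last first.
  by move=> x _; rewrite big_split /= cst.
by rewrite big_split /= cst -mulr_sumr; ring.
Qed.

(** * Expected number of uninformed vertices on a fixed network *)

Section Spread.
Variables (R : realType) (k t : nat) (st : apstate) (L : labels).
Hypothesis I : network_inv k t st L.
Local Notation N := (k + t)%N.

Definition uninformed (J : nat -> bool) : R := \sum_(v <- iota 0 N) miss R v J.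

(** The walk from [s] to [v] passes through the root, so its cost is a sum of one term in [s] and
    one in [v]; averaging over the source counts each term twice. *)
Lemma expect_uninformed_le r : (0 < k)%N -> (0 < r)%N ->
  expect (dunif R (iota 0 N)) (fun s =>
    expect (pushpull R N st r (fun v => v == s)) uninformed)
  <= (2 * k)%:R + 4 * (\sum_(u <- iota 0 N) root_cost k t L u)%:R / r%:R.
Proof.
move=> k0 r0; have rR : (0 : R) < r%:R by rewrite ltr0n.
have NR : (0 : R) < N%:R by rewrite ltr0n; lia.
(* The initial vertices other than 0 are not tree nodes. Pairs involving them get the trivial bound
   1, whence the term [2 * k]. *)
pose bad u := (u != 0%N) && (u < k)%N.
pose w u : R := 2 * (root_cost k t L u)%:R / r%:R.
have w0 u : 0 <= w u by rewrite divr_ge0// mulr_ge0.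
have miss1 s v : expect (pushpull R N st r (fun v => v == s)) (miss R v) <= 1.
  rewrite -[leRHS](expect_pushpull_cst (R := R) (inv_deg I) r (fun v => v == s)).
  by apply: ler_expect_supp (supp_pushpull _ _ _ r _) _ => J _; rewrite lern1 leq_b1.
have bound s v : s \in iota 0 N -> v \in iota 0 N ->
    expect (pushpull R N st r (fun v => v == s)) (miss R v)
      <= ((bad s)%:R + w s) + ((bad v)%:R + w v).
  rewrite !mem_iota /= !add0n => sN vN.
  have [bs|gs] := boolP (bad s).
    by apply: (le_trans (miss1 s v)); rewrite -!addrA lerDl !addr_ge0.
  have [bv|gv] := boolP (bad v).
    by apply: (le_trans (miss1 s v)); rewrite add0r [leRHS]addrCA lerDl !addr_ge0.
  have sv := walk_trans (walk_sym (walk_root I sN _)) (walk_root I vN _).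
  have := miss_pushpull_le R (inv_deg I) r (sv _ _).
  rewrite -ler_pdivlMl// => h; apply: (le_trans (h _ _)).
  - by move: gs; rewrite /bad; lia.
  - by move: gv; rewrite /bad; lia.
  by rewrite !add0r natrD !natrM mulrC mulrDl.
have badk : \sum_(u <- iota 0 N) (bad u)%:R <= (k%:R : R).
  rewrite -natr_sum ler_nat iotaD big_cat /= add0n [X in (_ + X)%N]big_seq.
  rewrite [X in (_ + X)%N]big1; last by move=> u; rewrite mem_iota /bad; lia.
  rewrite addn0 -[leqRHS](size_iota 0 k) -sum1_size; apply: leq_sum => u _; exact: leq_b1.
rewrite expect_unif size_iota ler_pdivrMl//.
rewrite (eq_bigr (fun s => \sum_(v <- iota 0 N)
  expect (pushpull R N st r (fun v => v == s)) (miss R v))); last first.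
  by move=> s _; apply: expect_sum.
pose S := \sum_(u <- iota 0 N) ((bad u)%:R + w u).
apply: (@le_trans _ _ (\sum_(s <- iota 0 N) \sum_(v <- iota 0 N)
    (((bad s)%:R + w s) + ((bad v)%:R + w v)))).
  rewrite big_seq [leRHS]big_seq; apply: ler_sum => s sN.
  by rewrite big_seq [leRHS]big_seq; apply: ler_sum => v vN; apply: bound.
rewrite (sum_pairs _ (fun u => (bad u)%:R + w u)) size_iota.
rewrite ler_pM2l// /S big_split /= -!mulr_suml -mulr_sumr natr_sum natrM.
by move: badk; lra.
Qed.

End Spread.

(** * Drift of the edge costs *)

Section Drift.
Variables (R : realType) (k : nat).
Hypothesis k_ge3 : (3 <= k)%N.

(** By exchanging sums, this is the total depth of the active cliques in the tree. *)
Definition descent (t : nat) (st : apstate) (L : labels) : R :=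
  \sum_(a <- iota k t) (descendants st L a)%:R.

(** Centring at [2 * k] absorbs the constant terms of the drift, which leaves a purely
    multiplicative recursion. *)
Definition excess (t : nat) (st : apstate) (L : labels) : R :=
  \sum_(a <- iota k t) ((exc L a)%:R - (2 * k)%:R) * (descendants st L a)%:R.

Lemma sum_count (T : Type) (P : pred T) (s : seq T) :
  \sum_(x <- s) (P x)%:R = (count P s)%:R :> R.
Proof. by rewrite -natr_sum -sum1_count [in RHS]big_mkcond; congr _%:R. Qed.

Lemma sum_iota_nth (T : Type) (x0 : T) (s : seq T) (F : T -> R) :
  \sum_(i <- iota 0 (size s)) F (nth x0 s i) = \sum_(x <- s) F x.
Proof. by rewrite (big_nth x0) /index_iota subn0. Qed.

Section Step.
Variables (t : nat) (st : apstate) (L : labels).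
Hypothesis I : network_inv k t st L.
Local Notation act := (ap_active st).
Local Notation v := (k + t)%N.
Local Notation M := ((size act)%:R : R).
Local Notation st' i := (ap_step k t st i).
Local Notation L' i := (label_step v (nth [::] act i) L).

(** The cliques through [a] and its parent are all below [a]. *)
Lemma descendants_ge a : (k <= a < v)%N -> (k - 1 <= descendants st L a)%N.
Proof.
move=> aN; apply: leq_trans (inv_pcount I aN) _.
rewrite (@eq_in_count _ _ (predI (fun c => (a \in c) && (par L a \in c))
  (fun c => anc L (head 0%N c) a))); first by apply: sub_count => c /andP[].
move=> c ca /=; case: (boolP (a \in c)) => //= ac.
by rewrite (inv_sub I aN)// ?ac// andbT.
Qed.

Lemma sum_descendants_step a : (k <= a < v)%N ->
  \sum_(i <- iota 0 (size act)) (descendants (st' i) (L' i) a)%:R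
    = (M + (k%:R - 1)) * (descendants st L a)%:R :> R.
Proof.
move=> aN; have av : a != v by lia.
rewrite big_seq (eq_bigr (fun i => (descendants st L a)%:R +
    (k%:R - 1) * (anc L (head 0%N (nth [::] act i)) a)%:R)); last first.
  move=> i; rewrite mem_iota => il; rewrite /descendants (count_anc_step k_ge3 I il av).
  by rewrite natrD natrM natrB 1?mulrC//; lia.
rewrite -big_seq big_split /= -mulr_sumr.
rewrite (sum_iota_nth [::] act (fun c => (anc L (head 0%N c) a)%:R)).
rewrite sum_count -/(descendants st L a) big_const_seq count_predT size_iota iter_addr_0.
by rewrite -[X in X + _]mulr_natl; ring.
Qed.

(* Hitting a clique through both ends of an edge resets the excess of the edge,
   and these cliques outnumber the growth [k - 2] of the set of cliques through
   the witness; this restoring force beats the size bias of the descendants. *)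
Lemma excess_vertex_step a : (k <= a < v)%N ->
  \sum_(i <- iota 0 (size act))
     ((exc (L' i) a)%:R - (2 * k)%:R) * (descendants (st' i) (L' i) a)%:R
  <= (M + (k%:R - 2)) * (((exc L a)%:R - (2 * k)%:R) * (descendants st L a)%:R) :> R.
Proof.
move=> aN; have av : a != v by lia.
set x : R := (exc L a)%:R; set b : R := (descendants st L a)%:R; set K : R := (2 * k)%:R.
have x0 : 0 <= x by [].
pose m (c : seq nat) : R := (anc L (head 0%N c) a)%:R.
pose w (c : seq nat) : R := (wit L a \in c)%:R.
pose r (c : seq nat) : R := ((a \in c) && (par L a \in c))%:R.
have b0 : k%:R - 1 <= b by rewrite lerBlDr /b natr1 ler_nat; have := descendants_ge aN; lia.
have k3 : (3 : R) <= k%:R by rewrite ler_nat.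
(* On a renewal [m c] is 1 and the terms in [x] cancel. Otherwise this is the exact product, since
   [w c = 1] forces [m c = 1]. *)
pose bound c := x * (b + (k%:R - 1) * m c) + (w c - x * r c) * (b + (k%:R - 1)).
have stepE i : (i < size act)%N ->
    (exc (L' i) a)%:R * (descendants (st' i) (L' i) a)%:R <= bound (nth [::] act i).
  move=> il; have := mem_nth [::] il; rewrite /bound.
  set c := nth [::] act i => ca.
  have sub : (a \in c) || (wit L a \in c) -> anc L (head 0%N c) a by apply: (inv_sub I aN).
  rewrite /descendants (count_anc_step k_ge3 I il av) natrD natrM natrB; last by lia.
  rewrite -/b -/c /= (renewed_old st L i aN) /m /w /r.
  have [/andP[ac _]|_] := boolP ((a \in c) && _).
    rewrite sub ?ac// mul0r !mulr1 -mulrDl addrC subrK mulr_ge0//; lra.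
  rewrite mulr0 subr0 natrD -/x; have [wc|_] := boolP (wit L a \in c).
    by rewrite sub ?wc ?orbT//=; lra.
  by case: (anc _ _ _) => /=; lra.
have wk : \sum_(c <- act) w c <= k%:R + x * (k%:R - 2).
  rewrite /w sum_count /x -natrB; last by lia.
  by rewrite -natrM -natrD ler_nat (inv_wcount I aN).
have rk : k%:R - 1 <= \sum_(c <- act) r c.
  rewrite /r (sum_count (fun c => (a \in c) && (par L a \in c))) -(natrB _ (n := 1)); last by lia.
  by rewrite ler_nat (inv_pcount I aN).
have -> : \sum_(i <- iota 0 (size act))
     ((exc (L' i) a)%:R - K) * (descendants (st' i) (L' i) a)%:R
   = \sum_(i <- iota 0 (size act)) (exc (L' i) a)%:R * (descendants (st' i) (L' i) a)%:R
     - K * ((M + (k%:R - 1)) * b) :> R.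
  rewrite -(sum_descendants_step aN) mulr_sumr -sumrB.
  by apply: eq_bigr => i _; rewrite mulrBl.
have h : \sum_(i <- iota 0 (size act)) (exc (L' i) a)%:R * (descendants (st' i) (L' i) a)%:R
    <= x * (M * b + (k%:R - 1) * b) + (k%:R + x * (k%:R - 2) - x * (k%:R - 1)) * (b + (k%:R - 1)).
  apply: (@le_trans _ _ (\sum_(i <- iota 0 (size act)) bound (nth [::] act i))).
    rewrite big_seq [leRHS]big_seq; apply: ler_sum => i; rewrite mem_iota => il.
    exact: stepE.
  rewrite sum_iota_nth big_split /= -mulr_sumr -mulr_suml sumrB -mulr_sumr.
  rewrite big_split /= -mulr_sumr big_const_seq count_predT iter_addr_0 -[b *+ _]mulr_natl.
  rewrite /m (sum_count (fun c => anc L (head 0%N c) a)) -/(descendants st L a) -/b.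
  rewrite lerD2l ler_wpM2r//; first by lra.
  by rewrite lerB// ler_wpM2l.
(* With the centring [2 * k] the two sides differ by exactly [x * (k - 1) + k * (b - (k - 1))],
   nonnegative by [xk] and [kb]. *)
have kb : 0 <= k%:R * (b - (k%:R - 1)) by rewrite mulr_ge0// subr_ge0.
have xk : 0 <= x * (k%:R - 1) by rewrite mulr_ge0//; lra.
rewrite /K natrM; move: h kb xk; nra.
Qed.

Lemma expect_excess_step :
  expect (dunif R (iota 0 (size act))) (fun i => excess t.+1 (st' i) (L' i))
    <= (1 + (k%:R - 2) / M) * excess t st L.
Proof.
have M0 : 0 < M by rewrite ltr0n (inv_size I).
have kv : (k <= v)%N by rewrite leq_addr.
rewrite expect_unif size_iota ler_pdivrMl// mulrA mulrDr mulr1 mulrCA mulfV ?gt_eqF// mulr1.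
rewrite /excess mulr_sumr.
under eq_bigr do rewrite -addn1 iotaD big_cat big_seq1 /=.
rewrite big_split /= exchange_big -[leRHS]addr0 lerD//.
  rewrite big_seq [leRHS]big_seq; apply: ler_sum => a; rewrite mem_iota => aN.
  exact: excess_vertex_step.
rewrite big_seq sumr_le0// => i _; rewrite /renewed eqxx.
by rewrite sub0r mulNr oppr_le0 mulr_ge0.
Qed.

(** A clique is hit in proportion to its count below [a], as in a Polya urn; the final [k] comes
    from the cliques below the new vertex. *)
Lemma expect_descent_step :
  expect (dunif R (iota 0 (size act))) (fun i => descent t.+1 (st' i) (L' i))
    = (1 + (k%:R - 1) / M) * descent t st L + k%:R.
Proof.
have M0 : 0 < M by rewrite ltr0n (inv_size I).
rewrite expect_unif size_iota /descent.
rewrite big_seq (eq_bigr (fun i => \sum_(a <- iota k t) (descendants (st' i) (L' i) a)%:R + k%:R));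
    last first.
  move=> i; rewrite mem_iota => il; rewrite -addn1 iotaD big_cat big_seq1 /=.
  by rewrite {2}/descendants (count_anc_new k_ge3 I il).
rewrite -big_seq big_split /= exchange_big big_const_seq count_predT size_iota iter_addr_0.
rewrite big_seq (eq_bigr (fun a => (M + (k%:R - 1)) * (descendants st L a)%:R)); last first.
  by move=> a; rewrite mem_iota => aN; apply: sum_descendants_step.
rewrite -big_seq -mulr_sumr -[_ *+ size act]mulr_natl; field.
by rewrite gt_eqF.
Qed.

End Step.
End Drift.

(** * Expectations over the random labelled network *)

Section Labelled.
Variables (R : realType) (k : nat).
Hypothesis k_ge3 : (3 <= k)%N.

(** The labels depend on the history of choices, so they are carried along; forgetting them recovers
    [apollonian]. *)
Fixpoint labelled (t : nat) : dist R (apstate * labels) :=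
  match t with
  | 0 => dret R (ap_init k, labels0)
  | t'.+1 => dbind (labelled t') (fun x =>
      dbind (dunif R (iota 0 (size (ap_active x.1)))) (fun i =>
        dret R (ap_step k t' x.1 i, label_step (k + t') (nth [::] (ap_active x.1) i) x.2)))
  end.

Lemma expect_labelled t (F : apstate -> R) :
  expect (labelled t) (fun x => F x.1) = expect (apollonian R k t) F.
Proof.
elim: t F => [|t IH] F /=; first by rewrite !expect_ret.
rewrite !expect_bind -IH; apply: eq_expect => x.
by rewrite !expect_bind; apply: eq_expect => i; rewrite !expect_ret.
Qed.

Lemma supp_labelled t : supp (labelled t) (fun x => network_inv k t x.1 x.2).
Proof.
elim: t => [|t IH] /=; first exact/supp_ret/inv_init.
apply: supp_bind IH _ => x Ix; apply: supp_bind (supp_unif R _) _ => i.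
by rewrite mem_iota => il; apply: supp_ret; apply: inv_step.
Qed.

Lemma expect_labelled_cst t a : expect (labelled t) (fun=> a) = a.
Proof.
elim: t => [|t IH] /=; first by rewrite expect_ret.
rewrite expect_bind -[RHS]IH; apply: eq_expect_supp (supp_labelled t) _ => x Ix.
rewrite expect_bind -[RHS](@expect_unif_cst R _ (iota 0 (size (ap_active x.1)))).
  by apply: eq_expect => i; rewrite expect_ret.
by rewrite size_iota (inv_size Ix).
Qed.

Local Notation cliques t := ((1 + (k - 1) * t)%N%:R : R).

Lemma cliquesS t : cliques t.+1 = cliques t + (k%:R - 1).
Proof. by rewrite mulnS addnCA addnC natrD natrB//; lia. Qed.

(** The excess starts as an empty sum, and each step multiplies its mean by a nonnegative factor, up
    to an inequality. *)
Lemma expect_excess_le0 t : expect (labelled t) (fun x => excess R k t x.1 x.2) <= 0.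
Proof.
elim: t => [|t IH] /=; first by rewrite expect_ret /excess big_nil.
rewrite expect_bind.
apply: (@le_trans _ _ (expect (labelled t) (fun x =>
    (1 + (k%:R - 2) / cliques t) * excess R k t x.1 x.2))).
  apply: ler_expect_supp (supp_labelled t) _ => x Ix.
  rewrite expect_bind -(inv_size Ix); under eq_expect do rewrite expect_ret.
  exact: expect_excess_step.
have k3 : (3 : R) <= k%:R by rewrite ler_nat.
rewrite expectZ mulr_ge0_le0// addr_ge0// divr_ge0//; lra.
Qed.

Definition harmonic_sum (t : nat) : R := \sum_(s < t) s.+1%:R^-1.

(** Dividing by the number of cliques turns the recursion into an increment [k / cliques t.+1], at
    most [k / t.+1]. *)
Lemma expect_descent_le t :
  expect (labelled t) (fun x => descent R k t x.1 x.2) <= cliques t * (k%:R * harmonic_sum t).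
Proof.
elim: t => [|t IH] /=.
  by rewrite expect_ret /descent /harmonic_sum big_nil big_ord0 !mulr0.
rewrite expect_bind.
rewrite (eq_expect_supp (supp_labelled t)
    (G := fun x => (1 + (k%:R - 1) / cliques t) * descent R k t x.1 x.2 + k%:R)); last first.
  move=> x Ix; rewrite expect_bind -(inv_size Ix) -(expect_descent_step R k_ge3 Ix).
  by apply: eq_expect => i; rewrite expect_ret.
have k3 : (3 : R) <= k%:R by rewrite ler_nat.
have M0 : 0 < cliques t by rewrite ltr0n.
have M1 : t.+1%:R <= cliques t.+1 by rewrite ler_nat; nia.
rewrite expectD expectZ expect_labelled_cst /harmonic_sum big_ord_recr /= -/(harmonic_sum t).
have c0 : 0 <= 1 + (k%:R - 1) / cliques t by rewrite addr_ge0// divr_ge0//; lra.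
apply: (@le_trans _ _ ((1 + (k%:R - 1) / cliques t) * (cliques t * (k%:R * harmonic_sum t)) + k%:R)).
  by rewrite lerD2r ler_wpM2l.
have -> : (1 + (k%:R - 1) / cliques t) * (cliques t * (k%:R * harmonic_sum t))
    = cliques t.+1 * (k%:R * harmonic_sum t).
  by rewrite cliquesS; move: (cliques t) M0 => c cM; field; rewrite gt_eqF.
rewrite !mulrDr lerD2l mulrCA -[leLHS]mulr1 ler_wpM2l//.
by rewrite ler_pdivlMr ?ltr0n// mul1r.
Qed.

Lemma harmonic_sum_le t : harmonic_sum t.+1 <= 1 + ln t.+1%:R.
Proof.
elim: t => [|t IH]; first by rewrite /harmonic_sum big_ord1 ln1 addr0 invr1.
rewrite /harmonic_sum big_ord_recr /= -/(harmonic_sum t.+1).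
apply: le_trans (lerD IH (lexx _)) _; rewrite -addrA lerD2l.
have t0 : (0 : R) < t.+1%:R by rewrite ltr0n.
have t1 : (0 : R) < t.+2%:R by rewrite ltr0n.
(* The inequality [ln (1 + x) <= x] at this [x] bounds the new harmonic term by a difference of
   logarithms. *)
have h : -1 < - t.+2%:R^-1 :> R by rewrite ltrN2 invf_lt1// ltr1n.
have := le_ln1Dx h; have -> : 1 - t.+2%:R^-1 = t.+1%:R / t.+2%:R :> R.
  have -> : t.+1%:R = t.+2%:R - 1 :> R by rewrite -[t.+2%:R]natr1 addrK.
  by move: (t.+2%:R) t1 => a a0; field; rewrite gt_eqF.
by rewrite ln_div ?posrE// lerBlDl lerBrDr.
Qed.

Lemma expect_uninformed_experiment n r : (0 < n)%N -> (0 < r)%N ->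
  expect (experiment R k n r) (uninformed R k n)
    <= (2 * k)%:R + (12 * k ^ 3)%:R * n%:R * (1 + ln n%:R) / r%:R.
Proof.
move=> n0 r0; have rR : (0 : R) < r%:R by rewrite ltr0n.
rewrite /experiment expect_bind -expect_labelled.
(* From [4 * (k + exc) = 4 * (exc - 2 * k) + 12 * k]. Two more factors [k] come from the number of
   cliques and from the mean depth. *)
pose bound (x : apstate * labels) : R :=
  4 / r%:R * excess R k n x.1 x.2 + 12 * k%:R / r%:R * descent R k n x.1 x.2.
apply: (@le_trans _ _ (expect (labelled n) (fun x => (2 * k)%:R + bound x))).
  apply: ler_expect_supp (supp_labelled n) _ => x Ix; rewrite expect_bind.
  apply: le_trans (expect_uninformed_le R Ix _ r0) _; first by lia.
  rewrite lerD2l mulrAC /bound.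
  have -> : 12 * k%:R / r%:R * descent R k n x.1 x.2 = 4 / r%:R * (3 * k%:R * descent R k n x.1 x.2).
    by field; rewrite gt_eqF.
  rewrite -mulrDr ler_wpM2l ?divr_ge0//.
  apply: (@le_trans _ _ (\sum_(a <- iota k n) (k + exc x.2 a) * descendants x.1 x.2 a)%N%:R).
    by rewrite ler_nat (sum_root_cost Ix).
  rewrite natr_sum /excess /descent mulr_sumr -big_split /=.
  by apply: ler_sum => a _; rewrite natrM natrD natrM; lra.
rewrite expectD expect_labelled_cst lerD2l /bound expectD !expectZ.
have D := expect_descent_le n; have X := expect_excess_le0 n.
have h1 : 4 / r%:R * expect (labelled n) (fun x => excess R k n x.1 x.2) <= 0.
  by rewrite mulr_ge0_le0// divr_ge0.
have cn : cliques n <= k%:R * n%:R by rewrite -natrM ler_nat; nia.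
have hn : harmonic_sum n <= 1 + ln n%:R by case: n n0 {D X h1 cn bound} => // n _; apply: harmonic_sum_le.
have h0 : 0 <= harmonic_sum n by apply: sumr_ge0.
apply: (@le_trans _ _ (12 * k%:R / r%:R * (k%:R * n%:R * (k%:R * (1 + ln n%:R))))).
  rewrite -[leRHS]add0r lerD// ler_wpM2l ?divr_ge0 ?mulr_ge0//.
  by apply: le_trans D _; rewrite ler_pM ?mulr_ge0// ler_wpM2l.
by rewrite natrM natrX le_eqVlt; apply/orP; left; apply/eqP; field; rewrite gt_eqF.
Qed.

End Labelled.

(** * Markov bound and asymptotics *)

Section Markov.
Variables (R : realType) (k n r : nat).
Hypothesis k_ge3 : (3 <= k)%N.

Lemma expect_experiment_cst a : expect (experiment R k n r) (fun=> a) = a.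
Proof.
rewrite /experiment expect_bind -expect_labelled -[RHS](expect_labelled_cst k_ge3 n).
apply: eq_expect_supp (supp_labelled R k_ge3 n) _ => x Ix; rewrite expect_bind.
rewrite -[RHS](@expect_unif_cst R _ (iota 0 (k + n))) ?size_iota; last by lia.
by apply: eq_expect => s; rewrite (expect_pushpull_cst (inv_deg Ix)).
Qed.

Lemma supp_experiment : supp (experiment R k n r) (fun=> True).
Proof.
apply: (supp_bind (P := fun=> True)) => [|st _].
  elim: n => [|t IH] /=; first exact: supp_ret.
  apply: supp_bind IH _ => st _; apply: supp_bind (supp_unif R _) _ => i _.
  exact: supp_ret.
apply: supp_bind (supp_unif R _) _ => s _.
exact: supp_imp (supp_pushpull R (k + n) st r _) _.
Qed.

Lemma uninformedE J : uninformed R k n J = (k + n)%:R - (num_informed k n J)%:R.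
Proof.
rewrite /uninformed /miss (sum_count R (predC J)) /num_informed.
by apply/esym/eqP; rewrite subr_eq addrC -natrD count_predC size_iota.
Qed.

Lemma prob_informed_le1 P : prob (experiment R k n r) P <= 1.
Proof.
rewrite probE -[leRHS]expect_experiment_cst.
by apply: ler_expect_supp supp_experiment _ => J _; rewrite lern1 leq_b1.
Qed.

(** Markov's inequality at threshold [g]: with fewer than [n - g] vertices informed, more than [g]
    are uninformed. *)
Lemma prob_informed_ge g : 0 < g ->
  1 - expect (experiment R k n r) (uninformed R k n) / g
    <= prob (experiment R k n r) (fun J => n%:R - g <= (num_informed k n J)%:R).
Proof.
move=> g0; rewrite mulrC probE -[X in X - _]expect_experiment_cst -expectZ -expectB.
apply: ler_expect_supp supp_experiment _ => J _; rewrite uninformedE natrD.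
have [_|] := lerP (n%:R - g) _.
  rewrite -[leRHS]/(1 : R) gerBl mulr_ge0 ?invr_ge0 ?(ltW g0)// subr_ge0 -natrD ler_nat.
  by rewrite -[leqRHS](size_iota 0) count_size.
move=> h; rewrite -[leRHS]/(0 : R) subr_le0 ler_pdivlMl// mulr1.
have k0 : (0 : R) <= k%:R by []; lra.
Qed.

End Markov.

(** The exponent of [ln n] is at least 1 because [(k - 1) ^ 2 <= k ^ 2 - 3], and the factor in [f n]
    is at least 1. *)
Lemma rounds_ge (R : realType) (k : nat) (f : nat -> R) (n : nat) : (3 <= k)%N ->
  1 <= ln n%:R :> R -> 1 <= f n ->
  ln n%:R * ln (ln n%:R) <= (rounds k 1 f n)%:R :> R.
Proof.
move=> k3 l1 f1; rewrite /rounds mul1r.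
set y := _ * ln (ln _) * _.
have ll0 : 0 <= ln (ln n%:R) :> R by rewrite ln_ge0.
have ly : ln n%:R * ln (ln n%:R) <= y.
  have p1 : ln n%:R <= powR (ln n%:R) ((k ^ 2 - 3)%N%:R / ((k - 1) ^ 2)%N%:R) :> R.
    rewrite le1r_powR// ler_pdivlMr ?mul1r ?ltr0n ?ler_nat; last by rewrite expn_gt0; lia.
    by rewrite -!mulnn; nia.
  have p2 : 1 <= powR (f n) (2 / k%:R).
    by rewrite -[leLHS](powRr0 (f n)) ler_powR// divr_ge0.
  rewrite /y -[leLHS]mulr1 ler_pM// ?mulr_ge0//; first by lra.
  by rewrite ler_wpM2r.
apply: (le_trans ly); apply: (le_trans (ceil_ge y)).
by rewrite [leRHS]pmulrn abszE ler_int ler_norm.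
Qed.

Lemma cvg_ln_pinfty (R : realType) : (ln n%:R : R) @[n --> \oo] --> +oo.
Proof.
apply/cvgryPge => A; near=> n.
have n0 : (expR A : R) <= n%:R by near: n; apply: nbhs_infty_ger.
by rewrite -(expRK A) ler_ln ?posrE ?expR_gt0// (lt_le_trans (expR_gt0 A)).
Unshelve. all: by end_near. Qed.

Lemma cvg_lnln_pinfty (R : realType) : (ln (ln n%:R) : R) @[n --> \oo] --> +oo.
Proof.
apply/cvgryPge => A; near=> n.
have n0 : (expR A : R) <= ln n%:R.
  by near: n; have /cvgryPge := @cvg_ln_pinfty R; apply.
by rewrite -(expRK A) ler_ln ?posrE ?expR_gt0// (lt_le_trans (expR_gt0 A)).
Unshelve. all: by end_near. Qed.

Theorem theorem3 (R : realType) (k : nat) (hk : (3 <= k)%N) (f : nat -> R)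
  (hf_inf : f n @[n --> \oo] --> +oo)
  (hf_small : f n / ln (ln n%:R) @[n --> \oo] --> 0) :
  exists C : R, 0 < C /\
  exists g : nat -> R, (g n / n%:R @[n --> \oo] --> 0) /\
  ((fun n : nat => prob (experiment R k n (rounds k C f n))
        (fun I => n%:R - g n <= (num_informed k n I)%:R))
     @ \oo --> (1 : R)).
Proof.
exists 1; split=> //.
pose ll n : R := ln (ln n%:R).
(* This bounds the mean uninformed count divided by [n]; 24 is twice 12, from
   [1 + ln n <= 2 * ln n]. *)
pose e n : R := (2 * k)%:R * n%:R^-1 + (24 * k ^ 3)%:R * (ll n)^-1.
have ll_pos : \forall n \near \oo, 1 <= ll n.
  by have /cvgryPge := @cvg_lnln_pinfty R; apply.
have e0 : e n @[n --> \oo] --> 0.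
  rewrite -[0]addr0 -{1}[0](mulr0 (2 * k)%:R) -{1}[0 in X in _ + X](mulr0 (24 * k ^ 3)%:R).
  apply: cvgD; apply: cvgMr.
    apply/gtr0_cvgV0; last exact/cvgryPge/nbhs_infty_ger.
    by near=> n; rewrite ltr0n; near: n; exact: nbhs_infty_gt.
  apply/gtr0_cvgV0; last exact: cvg_lnln_pinfty.
  by near=> n; apply: (@lt_le_trans _ _ 1) => //; near: n.
have se0 : Num.sqrt (e n) @[n --> \oo] --> 0.
  rewrite -[0](@sqrtr0 R); apply: (continuous_cvg _ _ e0).
  exact: sqrt_continuous.
(* The square root balances Markov's inequality: the allowed fraction and the failure probability
   are both [sqrt (e n)]. *)
exists (fun n => n%:R * Num.sqrt (e n)); split.
  apply: squeeze_cvgr (cvg_cst 0) se0; near=> n.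
  have n0 : (0 : R) < n%:R by rewrite ltr0n; near: n; exact: nbhs_infty_gt.
  by rewrite mulrAC mulfV ?gt_eqF// mul1r sqrtr_ge0 lexx.
apply: (@squeeze_cvgr _ _ _ _ (fun n => 1 - Num.sqrt (e n)) (fun=> 1)).
- near=> n; rewrite prob_informed_le1// andbT.
  have n0 : (0 < n)%N by near: n; exact: nbhs_infty_gt.
  have nR : (0 : R) < n%:R by rewrite ltr0n.
  have l1 : 1 <= ln n%:R :> R.
    by near: n; have /cvgryPge := @cvg_ln_pinfty R; apply.
  have f1 : 1 <= f n by near: n; move/cvgryPge : hf_inf; apply.
  have ll1 : 1 <= ll n by near: n.
  have r_ge := rounds_ge hk l1 f1.
  have l0 : 0 < ln n%:R :> R by lra.
  have ll0 : 0 < ll n by lra.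
  have rR : (0 : R) < (rounds k 1 f n)%:R by apply: lt_le_trans r_ge; rewrite mulr_gt0.
  have ep : 0 < e n.
    apply: ltr_wpDl; first by rewrite mulr_ge0// invr_ge0.
    by rewrite mulr_gt0 ?invr_gt0// ltr0n muln_gt0 expn_gt0; lia.
  have sp : 0 < Num.sqrt (e n) by rewrite sqrtr_gt0.
  apply: le_trans (prob_informed_ge _ _ hk (mulr_gt0 nR sp)).
  rewrite lerD2l lerN2 ler_pdivrMr ?mulr_gt0// mulrCA -expr2 sqr_sqrtr ?(ltW ep)//.
  apply: le_trans (expect_uninformed_experiment R hk n0 _) _; first by rewrite -(ltr0n R).
  have -> : n%:R * e n = (2 * k)%:R + n%:R * ((24 * k ^ 3)%:R / ll n).
    by rewrite /e mulrDr mulrCA mulfV ?gt_eqF// mulr1.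
  rewrite lerD2l.
  rewrite ler_pdivrMr//.
  apply: (@le_trans _ _ (n%:R * ((24 * k ^ 3)%:R / ll n) * (ln n%:R * ll n))).
    have -> : n%:R * ((24 * k ^ 3)%:R / ll n) * (ln n%:R * ll n) =
        (24 * k ^ 3)%:R * n%:R * ln n%:R by field; rewrite gt_eqF.
    rewrite !natrM -!mulrA.
    have : 0 <= (k ^ 3)%:R * n%:R :> R by rewrite mulr_ge0.
    by move: l1; nra.
  by rewrite ler_wpM2l// mulr_ge0// divr_ge0// (ltW ll0).
- by rewrite -[X in _ --> X]subr0; apply: cvgB => //; exact: cvg_cst.
- exact: cvg_cst.
Unshelve. all: by end_near. Qed.
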